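(* Suppose that $N$ is a non-negative integer-valued random variable defined on some probability space $(\Omega,\mathcal{F},\mathbb{P})$ with $\mathbb{P}(N=0)<1$, and, on the same space, $X_1,X_2,\ldots$ is a sequence of i.i.d. random variables with finite mean, independent of $N$. Suppose that $S_N:=\sum_{i=1}^N X_i$ is independent of $N-S_N$. (a) If $X_1\sim\mathrm{Bernoulli}(p)$ for some $p\in(0,1)$, then $N\sim\mathrm{Poisson}(\lambda)$ for some $\lambda>0$. (b) If $N\sim\mathrm{Poisson}(\lambda)$ for some $\lambda>0$, then $X_1\sim\mathrm{Bernoulli}(p)$ for some $p\in(0,1)$.
   Context: ''The sequence is independent of $N$'' means that $N$ is independent of the whole sequence $(X_i)_{i\ge1}$. An empty sum is $0$. $\mathrm{Bernoulli}(p)$ is the law with mass $p$ at $1$ and $1-p$ at $0$. $\mathrm{Poisson}(\lambda)$ is the law on the non-negative integers with mass $e^{-\lambda}\lambda^k/k!$ at $k$.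
   Formalization: Part (b) additionally assumes P(X_1=0)<1 and P(X_1=1)<1, since it fails as stated: if all X_i=0 (or all X_i=1) and N is Poisson, then S_N and N−S_N are independent but X_1 is not Bernoulli(p) with p in (0,1). *)

(* Defs.v *)
From HB Require Import structures.
From mathcomp Require Import all_boot all_order all_algebra finmap.
From mathcomp Require Import all_classical all_reals all_analysis.

Set Implicit Arguments.
Unset Strict Implicit.
Unset Printing Implicit Defensive.

Import Order.TTheory GRing.Theory Num.Theory.
Import numFieldNormedType.Exports.

Local Open Scope classical_set_scope.
Local Open Scope ring_scope.

Section independence.
Context (d d' : measure_display) (T : measurableType d) (T' : measurableType d')
  (R : realType) (P : probability T R).

Definition indep_systems (F G : set_system T) : Prop :=
  forall A B, F A -> G B -> P (A `&` B) = (P A * P B)%E.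

(* For a measurable X this is the sigma-algebra sigma(X). *)
Definition sigma_rv (X : T -> T') : set_system T :=
  preimage_set_system [set: T] X measurable.

Definition sigma_seq (X : nat -> T -> T') : set_system T :=
  <<s \bigcup_i sigma_rv (X i) >>.

Definition mutually_indep (X : nat -> T -> T') : Prop :=
  forall (J : {fset nat}) (A : nat -> set T'),
    (forall i, i \in J -> measurable (A i)) ->
    P (\bigcap_(i in [set` J]) X i @^-1` A i) =
      (\prod_(i <- J) P (X i @^-1` A i))%E.

Definition identically_distributed (X : nat -> {RV P >-> T'}) : Prop :=
  forall i A, measurable A -> distribution P (X i) A = distribution P (X 0%N) A.

Definition iid (X : nat -> {RV P >-> T'}) : Prop :=
  mutually_indep X /\ identically_distributed X.

End independence.

Section laws.
Context (d : measure_display) (T : measurableType d) (R : realType)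
  (P : probability T R).

(* The second argument of the library's poisson_prob is not used in its body. *)
Definition has_poisson_law (N : {RV P >-> nat}) (lambda : R) : Prop :=
  forall A : set nat, distribution P N A = poisson_prob lambda 0%N A.

(* bernoulli_prob p lives on bool; its image under b |-> b%:R is the law on R
   with mass p at 1 and 1 - p at 0. *)
Definition has_bernoulli_law (X : {RV P >-> R}) (p : R) : Prop :=
  forall A : set R, measurable A ->
    distribution P X A = pushforward (bernoulli_prob p) (fun b : bool => b%:R : R) A.

End laws.

(* The sequence X_1, X_2, ... is indexed from 0: X i stands for X_(i+1). *)
Definition random_sum (T : Type) (R : realType) (N : T -> nat)
    (X : nat -> T -> R) (w : T) : R :=
  \sum_(i < N w) X i w.

(* Main.v *)
Require Import Defs.
From HB Require Import structures.
From mathcomp Require Import all_boot all_order all_algebra finmap.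
From mathcomp Require Import all_classical all_reals all_analysis.
From mathcomp Require Import measurable_realfun ring.

Set Implicit Arguments.
Unset Strict Implicit.
Unset Printing Implicit Defensive.

Import Order.TTheory GRing.Theory Num.Theory.
Import numFieldNormedType.Exports.

Local Open Scope classical_set_scope.
Local Open Scope ring_scope.

(** Let S be the random sum and D = N - S.

    From Bernoulli summands to a Poisson N. Up to a null set the summands are
    0 or 1, so S counts the successes among the first N trials, and given
    N = n it is binomial. Independence of S and D therefore reads
    P(S = a) P(D = b) = P(N = a + b) C(a + b, a) p^a (1 - p)^b
    ([bernoulli_split_formula]). Multiplying by a! b! and dividing by the
    powers of p and 1 - p shows that h(n) = n! P(N = n) satisfies
    h(a + b) = u(a) v(b); such an h is a geometric sequence
    ([split_product_geometric]), so the masses of N are proportional to those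
    of a Poisson law, and two probabilities with proportional masses are equal.

    From a Poisson N to Bernoulli summands. The key is that S and D
    both have an atom at 0. On the event D = 0, which has positive probability because
    it contains N = 0, the sum S equals N and so is a natural number. As S is
    independent of D, it is almost surely a natural number; by symmetry so is
    D ([indep_natural_sum]). On N = 1, again of positive probability and
    independent of the first summand X, one has S = X and D = 1 - X. So X and
    1 - X are both natural numbers almost surely, that is, X is 0 or 1
    ([one_summand_two_valued]), and a law carried by 0 and 1 that is not
    degenerate is a Bernoulli law with parameter in the open interval (0, 1). *)

(** * Measures and sequences *)

Lemma eq_measure_on_full (R : realType) d (T : measurableType d)
    (P : probability T R) (A B E : set T) :
  measurable A -> measurable B -> P.-negligible (~` E) ->
  A `&` E = B `&` E -> P A = P B.
Proof.
move=> mA mB [F [mF F0 EF]] AB.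
have step C : measurable C -> P C = P (C `&` ~` F).
  move=> mC; rewrite [LHS](measureDI P mC mF) setDE.
  rewrite [X in (_ + X)%E](_ : _ = 0%E) ?adde0//.
  apply/eqP; rewrite eq_le measure_ge0 andbT -F0 le_measure ?inE//.
  exact: measurableI.
rewrite step// [RHS]step//; congr (P _).
have FE w : (~` F) w -> E w by move=> nF; apply: contrapT => /EF.
have AE w : ~ F w -> A w = B w.
  move=> /FE Ew; have := congr1 (fun C => C w) AB; rewrite /setI /= => ABw.
  rewrite propeqE; split=> Cw.
    by have : A w /\ E w by []; rewrite ABw => -[].
  by have : B w /\ E w by []; rewrite -ABw => -[].
by apply/seteqP; split=> w [Cw nFw]; split=> //; rewrite ?AE// -?AE.
Qed.

Lemma measure_nat_proportional (R : realType)
    (m1 m2 : {measure set nat -> \bar R}) (c : R) :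
  (forall n, m1 [set n] = (c%:E * m2 [set n])%E) ->
  forall A, m1 A = (c%:E * m2 A)%E.
Proof.
move=> m12 A.
have tA : trivIset A (fun n : nat => [set n]).
  by move=> i j _ _ [x [/= -> ->]].
have UA : A = \bigcup_(n in A) [set n] by rewrite -[LHS]image_id -bigcup_imset1.
rewrite UA !measure_bigcup// -nneseriesZl//.
by apply: eq_eseriesr => n _; exact: m12.
Qed.

Lemma poisson_prob1 (R : realType) (c : R) n : 0 < c ->
  poisson_prob c 0%N [set n] = (c ^+ n / n`!%:R * expR (- c))%:E.
Proof.
move=> c0; rewrite /poisson_prob c0 esum_set1 /poisson_pmf c0//.
by rewrite lee_fin !mulr_ge0 ?exprn_ge0 ?expR_ge0 ?ltW.
Qed.

(** Putting a = 0 or b = 0 shows that u and v are both proportional to h, which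
    turns the hypothesis into h(a + b) h(0) = h(a) h(b). A nonzero value of h
    at a positive index forces h(0) and the ratio h(1) / h(0) to be nonzero. *)
Lemma split_product_geometric (R : realFieldType) (h u v : nat -> R) :
  (forall a b, h (a + b)%N = u a * v b) ->
  (forall n, 0 <= h n) -> (exists2 n, (0 < n)%N & h n != 0) ->
  exists2 c, 0 < c & forall n, h n = h 0%N * c ^+ n.
Proof.
move=> huv h_ge0 [n n_gt0 hn].
have u0 : u 0%N != 0.
  by apply: contraNneq hn => u0; rewrite -[n]add0n huv u0 mul0r.
have v0 : v 0%N != 0.
  by apply: contraNneq hn => v0; rewrite -[n]addn0 huv v0 mulr0.
have h0 : h 0%N != 0 by rewrite -[0%N]addn0 huv mulf_neq0.
have hS m : h m.+1 = h m * (h 1%N / h 0%N).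
  apply: (mulIf h0); rewrite mulrA divfK//.
  rewrite -addn1 -[m in RHS]addn0 -[1%N in RHS]add0n -[0%N in LHS]addn0 !huv.
  by ring.
have hX m : h m = h 0%N * (h 1%N / h 0%N) ^+ m.
  by elim: m => [|m IH]; rewrite ?expr0 ?mulr1// (hS m) IH exprSr -mulrA.
exists (h 1%N / h 0%N) => //; rewrite lt_def divr_ge0// andbT.
by apply: contraNneq hn => c0; rewrite hX c0 expr0n eqn0Ngt n_gt0 mulr0.
Qed.

(** * Number of successes in independent trials *)

Definition successes (T T' : Type) (B : set T') (X : nat -> T -> T') n (w : T) :
    nat :=
  \sum_(i < n) (X i w \in B).

Section successes.
Context (d d' : measure_display) (T : measurableType d) (T' : measurableType d')
  (R : realType) (P : probability T R) (X : nat -> {RV P >-> T'}) (B : set T').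
Context (mB : measurable B).

Lemma successes0 (w : T) : successes B X 0 w = 0%N.
Proof. by rewrite /successes big_ord0. Qed.

Lemma successesS n (w : T) :
  successes B X n.+1 w = (successes B X n w + (X n w \in B))%N.
Proof. by rewrite /successes big_ord_recr. Qed.

Lemma successesS_eq0 n : [set w | successes B X n.+1 w = 0%N] =
  [set w | successes B X n w = 0%N] `&` X n @^-1` (~` B).
Proof.
apply/seteqP; split=> w /=; rewrite successesS.
  move/eqP; rewrite addn_eq0 => /andP[/eqP-> /eqP XB].
  by split=> // /mem_set; case: (_ \in _) XB.
by move=> [-> nB]; rewrite memNset.
Qed.

Lemma successesS_eqS n k : [set w | successes B X n.+1 w = k.+1] =
  ([set w | successes B X n w = k] `&` X n @^-1` B) `|`
  ([set w | successes B X n w = k.+1] `&` X n @^-1` (~` B)).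
Proof.
apply/seteqP; split=> w /=; rewrite successesS.
  have [XB|XB] := boolP (X n w \in B).
    by rewrite addn1 => -[]; left; split=> //; exact: set_mem.
  by rewrite addn0; right; split=> //; move: XB; rewrite notin_setE.
by move=> [[-> XB]|[-> XB]]; rewrite ?(mem_set XB) ?(memNset XB) ?addn1 ?addn0.
Qed.

Lemma sigma_seq_preimage n C : measurable C -> sigma_seq X (X n @^-1` C).
Proof.
move=> mC; apply: sub_sigma_algebra; exists n => //.
by exists C => //; rewrite setTI.
Qed.

Lemma sigma_seq_measurable : sigma_seq X `<=` measurable.
Proof.
apply: smallest_sub; first exact: sigma_algebra_measurable.
by move=> _ [n _ [C mC <-]]; exact: measurable_funP.
Qed.

Lemma sigma_seq_successes n k : sigma_seq X [set w | successes B X n w = k].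
Proof.
pose G := \bigcup_i sigma_rv (X i).
have mX i C : measurable C -> G.-sigma.-measurable (X i @^-1` C).
  exact: sigma_seq_preimage.
rewrite -[sigma_seq X _]/(G.-sigma.-measurable _).
elim: n k => [|n IH] [|k].
- rewrite (_ : [set _ | _] = setT)//.
  by apply/seteqP; split=> // w _ /=; exact: successes0.
- rewrite (_ : [set _ | _] = set0)//.
  by apply/seteqP; split=> // w /=; rewrite successes0.
- rewrite successesS_eq0.
  by apply: measurableI; [exact: IH|apply: mX; exact: measurableC].
- rewrite successesS_eqS; apply: measurableU; apply: measurableI; try exact: IH.
    exact: mX.
  by apply: mX; exact: measurableC.
Qed.

Lemma mutually_indep_range n l (A : nat -> set T') :
  mutually_indep P X -> (forall i, measurable (A i)) ->
  P (\bigcap_(i in [set i | n <= i < n + l]%N) X i @^-1` A i) =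
  (\prod_(n <= i < n + l) P (X i @^-1` A i))%E.
Proof.
move=> indX mA; pose J := seq_fset tt (index_iota n (n + l)).
have -> : [set i | n <= i < n + l]%N = [set` J].
  by apply/seteqP; split=> i /=; rewrite seq_fsetE mem_index_iota.
rewrite indX//; apply: perm_big; rewrite (perm_trans (seq_fset_perm _ _))//.
by rewrite undup_id// iota_uniq.
Qed.

(** The cylinder over the later indices makes the induction on n go through
    from the product formulas alone: splitting on the outcome of trial n moves
    one more factor into the cylinder. *)
Lemma successes_cylinder p n k l (A : nat -> set T') :
  mutually_indep P X -> (forall i, P (X i @^-1` B) = p%:E) ->
  (forall i, measurable (A i)) ->
  P ([set w | successes B X n w = k] `&`
     \bigcap_(i in [set i | n <= i < n + l]%N) X i @^-1` A i) =
  (('C(n, k)%:R * p ^+ k * (1 - p) ^+ (n - k))%:E *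
   \prod_(n <= i < n + l) P (X i @^-1` A i))%E.
Proof.
move=> indX PB.
have PCB i : P (X i @^-1` (~` B)) = (1 - p)%:E.
  by rewrite preimage_setC probability_setC ?PB//; exact: measurable_funPTI.
have cyl m r C D :
  (X m @^-1` C `&` \bigcap_(i in [set i | m < i < m.+1 + r]%N) X i @^-1` D i) =
  \bigcap_(i in [set i | m <= i < m + r.+1]%N)
    X i @^-1` (if i == m then C else D i).
  rewrite addSnnS; apply/seteqP; split=> w.
    move=> [Cw Dw] i /= /andP[mi ir]; case: eqP => [->//|/eqP im].
    by apply: Dw; rewrite /= ir ltn_neqAle eq_sym im mi.
  move=> CDw; split.
    by have := CDw m; rewrite /= eqxx; apply; rewrite leqnn addnS ltnS leq_addr.
  move=> i /= /andP[mi ir]; have := CDw i; rewrite /= gtn_eqF//.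
  by apply; rewrite ltnW.
have prd m r C D :
    (\prod_(m <= i < m + r.+1) P (X i @^-1` (if i == m then C else D i)) =
     P (X m @^-1` C) * \prod_(m.+1 <= i < m.+1 + r) P (X i @^-1` D i))%E.
  rewrite addSnnS big_ltn; last by rewrite addnS ltnS leq_addr.
  rewrite eqxx; congr (_ * _)%E.
  by apply: eq_big_nat => i /andP[mi _]; rewrite gtn_eqF.
elim: n k l A => [|n IH] k l A mA.
  case: k => [|k].
    rewrite bin0 expr0 !mulr1 mul1e -mutually_indep_range//.
    rewrite [X in X `&` _](_ : _ = setT) ?setTI//.
    by apply/seteqP; split=> // w _ /=; rewrite successes0.
  rewrite bin0n /= !mul0r mul0e -[RHS](measure0 P); congr (P _).
  by apply/seteqP; split=> w //= []; rewrite successes0.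
have mI C i : measurable C -> measurable (if i == n then C else A i).
  by case: ifP.
case: k => [|k].
  rewrite successesS_eq0 -setIA cyl.
  rewrite IH; last by move=> i; apply: mI; exact: measurableC.
  rewrite prd PCB !bin0 !subn0 muleA -EFinM; congr (_%:E * _)%E.
  by rewrite exprSr; ring.
have mS j : measurable [set w | successes B X n w = j].
  by apply: sigma_seq_measurable; exact: sigma_seq_successes.
have mCB := measurableC mB.
have mcap m r D : (forall i, measurable (D i)) ->
    measurable (\bigcap_(i in [set i | m <= i < m + r]%N) X i @^-1` D i).
  by move=> mD; apply: bigcap_measurableType => i _; exact: measurable_funPTI.
rewrite successesS_eqS setIUl -!setIA !cyl// measureU; first last.
- apply/seteqP; split=> w //= [[_ +] [_ +]] => /(_ n) + /(_ n).
  by rewrite /= eqxx leqnn addnS ltnS leq_addr => /(_ isT) + /(_ isT).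
- by apply: measurableI => //; apply: mcap => i; exact: mI.
- by apply: measurableI => //; apply: mcap => i; exact: mI.
have IHk j C : measurable C -> P ([set w | successes B X n w = j] `&`
    \bigcap_(i in [set i | n <= i < n + l.+1]%N)
      X i @^-1` (if i == n then C else A i)) =
    (('C(n, j)%:R * p ^+ j * (1 - p) ^+ (n - j))%:E *
     (P (X n @^-1` C) * \prod_(n.+1 <= i < n.+1 + l) P (X i @^-1` A i)))%E.
  by move=> mC; rewrite -prd; apply: IH => i; exact: mI.
rewrite [LHS](congr2 (fun x y => x + y)%E (IHk k _ mB) (IHk k.+1 _ mCB)) PB PCB.
set Q := (\prod_(_ <= _ < _) _)%E.
have Qfin : (Q \is a fin_num)%E.
  by rewrite /Q -mutually_indep_range// fin_num_measure//; exact: mcap.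
rewrite -(fineK Qfin) -!EFinM -EFinD; congr (_%:E).
(* Pascal's rule; for n <= k the second binomial coefficient vanishes, so the
   truncated exponent n - k.+1 is harmless. *)
rewrite binS subSS; have [kn|nk] := ltnP k n.
  by rewrite -(subnSK kn) natrD !exprS; ring.
by rewrite (@bin_small n k.+1 nk) exprS; ring.
Qed.

Lemma binomial_successes p n k :
  mutually_indep P X -> (forall i, P (X i @^-1` B) = p%:E) ->
  P [set w | successes B X n w = k] =
  ('C(n, k)%:R * p ^+ k * (1 - p) ^+ (n - k))%:E.
Proof.
move=> indX PB.
have := @successes_cylinder p n k 0 (fun=> setT) indX PB (fun=> measurableT).
rewrite addn0 big_geq// mule1 => <-; congr (P _).
by apply/seteqP; split=> w // [].
Qed.

End successes.

(** * Measurability of the random sum *)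

Section random_sum.
Context (d : measure_display) (T : measurableType d) (R : realType)
  (P : probability T R) (N : {RV P >-> nat}) (X : nat -> {RV P >-> R}).
Local Notation S := (random_sum N X).
Local Notation D := (fun w => (N w)%:R - random_sum N X w).

Lemma measurable_random_sum_comp (g : nat -> R -> R) C :
  (forall n, measurable_fun setT (g n)) -> measurable C ->
  measurable [set w | C (g (N w) (S w))].
Proof.
move=> mg mC.
rewrite (_ : [set _ | _] = \bigcup_n (N @^-1` [set n] `&`
   (fun w => g n (\sum_(i < n) X i w)) @^-1` C)).
  apply: bigcup_measurable => n _; apply: measurableI.
    exact: measurable_funPTI.
  rewrite -[X in measurable X]setTI; apply: measurableT_comp => //.
  by apply: measurable_sum => i; exact: measurable_funPT.
apply/seteqP; split=> w /=; first by exists (N w).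
by move=> [n _ [/= <-]].
Qed.

Lemma measurable_random_sum C : measurable C -> measurable (S @^-1` C).
Proof. by move=> mC; exact: (@measurable_random_sum_comp (fun=> id)). Qed.

Lemma measurable_sub_random_sum C : measurable C -> measurable (D @^-1` C).
Proof.
move=> mC; apply: (@measurable_random_sum_comp (fun n x => n%:R - x)) => // n.
exact: measurable_funB.
Qed.

End random_sum.

(** * Independent variables whose sum is a natural number *)

Definition naturals (R : realType) : set R := range (fun n : nat => n%:R).
Arguments naturals : clear implicits.

Section natural_values.
Context (d : measure_display) (T : measurableType d) (R : realType)
  (P : probability T R).

Lemma indep_systemsC F G : indep_systems P F G -> indep_systems P G F.
Proof. by move=> FG A B GA FB; rewrite setIC FG// muleC. Qed.

Lemma sigma_rv_preimage (U : T -> R) C : measurable C -> sigma_rv U (U @^-1` C).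
Proof. by move=> mC; exists C => //; rewrite setTI. Qed.

Lemma measurable_naturals : measurable (naturals R).
Proof.
rewrite /naturals -bigcup_imset1.
by apply: bigcup_measurable => n _; exact: measurable_set1.
Qed.

(** On the event V = 0 the variable U equals the sum U + V. That event has
    positive probability and is independent of U, so whatever U satisfies
    almost surely there, it satisfies almost surely everywhere. *)
Lemma indep_natural_sum (U V : T -> R) :
  indep_systems P (sigma_rv U) (sigma_rv V) ->
  (forall w, naturals R (U w + V w)) ->
  P (V @^-1` [set 0]) != 0%E -> P (U @^-1` (~` naturals R)) = 0%E.
Proof.
move=> UV UVN V0; apply/eqP; move: V0; apply: contraNT => U0.
have : P (U @^-1` (~` naturals R) `&` V @^-1` [set 0]) = 0%E.
  rewrite -[RHS](measure0 P); congr (P _); apply/seteqP; split=> w //=.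
  by move=> [nU V0]; apply: nU; have := UVN w; rewrite V0 addr0.
rewrite UV; first by move/eqP; rewrite mule_eq0 (negbTE U0).
  by apply: sigma_rv_preimage; apply: measurableC; exact: measurable_naturals.
by apply: sigma_rv_preimage; exact: measurable_set1.
Qed.

Lemma natural_complement (x : R) : naturals R x -> naturals R (1 - x) ->
  x = 0 \/ x = 1.
Proof.
move=> [n _ <-] [m _ mn].
have : (m + n = 1)%N by apply/eqP; rewrite -(eqr_nat R) natrD mn subrK.
by case: n {mn} => [|[|n]]; [left|right|rewrite !addnS].
Qed.

End natural_values.

(** * Bernoulli laws *)

Section bernoulli_law.
Context (d : measure_display) (T : measurableType d) (R : realType)
  (P : probability T R) (X : {RV P >-> R}).

Lemma has_bernoulli_law_eq1 p : 0 < p < 1 -> has_bernoulli_law X p ->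
  P (X @^-1` [set 1]) = p%:E.
Proof.
move=> /andP[p0 p1] /(_ _ (measurable_set1 1)).
rewrite /distribution /pushforward /= => ->; rewrite bernoulli_probE ?ltW//.
rewrite !diracE mem_set// memNset/= ?mule1 ?mule0 ?adde0//.
by move/eqP; rewrite eq_sym oner_eq0.
Qed.

Lemma has_bernoulli_law_neq01 p : 0 < p < 1 -> has_bernoulli_law X p ->
  P (X @^-1` (~` [set 0; 1])) = 0%E.
Proof.
move=> /andP[p0 p1] XB.
have m01 : measurable (~` [set 0; 1 : R]).
  by apply: measurableC; apply: measurableU; exact: measurable_set1.
have := XB _ m01; rewrite /distribution /pushforward /= => ->.
rewrite bernoulli_probE ?ltW// !diracE !memNset/= ?mule0 ?adde0//.
  by apply; left.
by apply; right.
Qed.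

Lemma two_valued_bernoulli_law :
  P (X @^-1` (~` [set 0; 1])) = 0%E ->
  (P (X @^-1` [set 0%R]) < 1)%E -> (P (X @^-1` [set 1%R]) < 1)%E ->
  exists p, 0 < p < 1 /\ has_bernoulli_law X p.
Proof.
move=> X01 X0lt X1lt.
have m0 := @measurable_set1 R 0; have m1 := @measurable_set1 R 1.
have m01 : measurable ([set 0; 1] : set R) by exact: measurableU.
pose q := fine (P (X @^-1` [set 0])); pose p := fine (P (X @^-1` [set 1])).
have Pq : P (X @^-1` [set 0]) = q%:E.
  by rewrite fineK// fin_num_measure//; exact: measurable_funPTI.
have Pp : P (X @^-1` [set 1]) = p%:E.
  by rewrite fineK// fin_num_measure//; exact: measurable_funPTI.
have PA A : measurable A ->
    P (X @^-1` A) = (p%:E * \d_(1%R : R) A + q%:E * \d_(0%R : R) A)%E.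
  move=> mA.
  have point (c r : R) : measurable [set c] -> P (X @^-1` [set c]) = r%:E ->
      P (X @^-1` (A `&` [set c])) = (r%:E * \d_c A)%E.
    move=> mc Pr; rewrite diracE; case: (pselect (A c)) => Ac.
      rewrite mem_set// mule1 -Pr; congr (P (X @^-1` _)).
      by apply/seteqP; split=> [x []|x ->].
    rewrite memNset// mule0 -[RHS](measure0 P); congr (P _).
    by apply/seteqP; split=> w //= [+ Xc]; rewrite Xc.
  rewrite -(point 1)// -(point 0)// -measureU; first last.
  - apply/seteqP; split=> w //= [[_ ->] [_ /eqP]]; by rewrite oner_eq0.
  - by apply: measurable_funPTI; exact: measurableI.
  - by apply: measurable_funPTI; exact: measurableI.
  apply: (@eq_measure_on_full _ _ _ _ _ _ (X @^-1` [set 0; 1])).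
  - exact: measurable_funPTI.
  - rewrite -preimage_setU; apply: measurable_funPTI.
    by apply: measurableU; exact: measurableI.
  - rewrite preimage_setC; apply/negligibleP => //.
    by apply: measurable_funPTI; exact: measurableC.
  - by apply/seteqP; split=> w /=; tauto.
have pq : q = 1 - p.
  have := PA _ measurableT.
  rewrite preimage_setT probability_setT !diracT !mule1 -EFinD => -[->].
  by rewrite addrC addKr.
rewrite Pq Pp !lte_fin in X0lt X1lt; rewrite pq in X0lt.
have p01 : 0 < p < 1 by rewrite X1lt andbT; move: X0lt; rewrite gtrBl.
exists p; split=> // A mA.
rewrite /distribution /pushforward /= PA// pq bernoulli_probE.
  by rewrite !diracE.
by case/andP: p01 => *; rewrite !ltW.
Qed.

End bernoulli_law.

(** * The two implications *)

Section split_of_random_sum.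
Context (R : realType) (d : measure_display) (T : measurableType d)
  (P : probability T R) (N : {RV P >-> nat}) (X : nat -> {RV P >-> R}).
Context (X_iid : iid X)
  (X_indep_N : indep_systems P (sigma_rv N) (sigma_seq X))
  (S_indep : indep_systems P (sigma_rv (random_sum N X))
     (sigma_rv (fun w => (N w)%:R - random_sum N X w))).
Local Notation S := (random_sum N X).
Local Notation D := (fun w => (N w)%:R - random_sum N X w).

Lemma sigma_rv_nat n : sigma_rv N (N @^-1` [set n]).
Proof. by exists [set n] => //; rewrite setTI. Qed.

(** Both S and N - S vanish when N = 0, so each has an atom at 0 and the other
    is therefore almost surely a natural number. The case N = 1 then transfers
    this to the first summand and its complement to 1. *)
Lemma one_summand_two_valued : P (N @^-1` [set 0%N]) != 0%E ->
  P (N @^-1` [set 1%N]) != 0%E -> P (X 0%N @^-1` (~` [set 0; 1])) = 0%E.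
Proof.
move=> N0 N1.
have mCNat := measurableC (@measurable_naturals R).
have mN n : measurable (N @^-1` [set n]) by exact: measurable_funPTI.
have le0 A B : measurable A -> measurable B -> A `<=` B -> P B = 0%E ->
    P A = 0%E.
  move=> mA mB AB B0; apply/eqP.
  by rewrite eq_le measure_ge0 andbT -B0 le_measure ?inE.
have pos (V : T -> R) : measurable (V @^-1` [set 0]) ->
    (forall w, N w = 0%N -> V w = 0) -> P (V @^-1` [set 0]) != 0%E.
  move=> mV NV; apply: contra_neq N0; apply: le0 => // w /=; exact: NV.
have S0 w : N w = 0%N -> S w = 0 by rewrite /random_sum => ->; rewrite big_ord0.
have D0 w : N w = 0%N -> D w = 0 by move=> Nw; rewrite S0// Nw subrr.
have SN : P (S @^-1` (~` naturals R)) = 0%E.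
  apply: (indep_natural_sum S_indep).
    by move=> w; exists (N w) => //; rewrite subrKC.
  by apply: pos => //; apply: measurable_sub_random_sum; exact: measurable_set1.
have DN : P (D @^-1` (~` naturals R)) = 0%E.
  apply: (indep_natural_sum (indep_systemsC S_indep)).
    by move=> w; exists (N w) => //; rewrite subrK.
  by apply: pos => //; apply: measurable_random_sum; exact: measurable_set1.
(* A null event for V is null for the first summand as soon as the two agree
   on N = 1, because N is independent of the summands. *)
have first_step C (V : T -> R) B : measurable C -> measurable (V @^-1` B) ->
    (forall w, N w = 1%N -> C (X 0%N w) -> B (V w)) ->
    P (V @^-1` B) = 0%E -> P (X 0%N @^-1` C) = 0%E.
  move=> mC mV CV V0; apply/eqP; move: N1; apply: contraNT => X0.
  have : P (N @^-1` [set 1%N] `&` X 0%N @^-1` C) = 0%E.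
    apply: le0 V0 => //.
      by apply: measurableI => //; exact: measurable_funPTI.
    by move=> w [/= Nw Cw]; exact: CV.
  rewrite X_indep_N; [|exact: sigma_rv_nat|exact: sigma_seq_preimage].
  by move/eqP; rewrite mule_eq0 (negbTE X0) orbF.
have S1 w : N w = 1%N -> S w = X 0%N w.
  by rewrite /random_sum => ->; rewrite big_ord1.
have m1B : measurable [set x : R | ~ naturals R (1 - x)].
  rewrite -[X in measurable X]setTI.
  have mB : measurable_fun setT (fun x : R => 1 - x) by exact: measurable_funB.
  exact: (mB measurableT _ mCNat).
have XN : P (X 0%N @^-1` (~` naturals R)) = 0%E.
  apply: (first_step _ S) SN => //; first exact: measurable_random_sum.
  by move=> w /S1 ->.
have X1N : P (X 0%N @^-1` [set x | ~ naturals R (1 - x)]) = 0%E.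
  apply: (first_step _ D) DN => //; first exact: measurable_sub_random_sum.
  by move=> w Nw; rewrite S1// Nw.
have m01 : measurable (~` [set 0; 1 : R]).
  by apply: measurableC; apply: measurableU; exact: measurable_set1.
apply: (le0 _ (X 0%N @^-1` (~` naturals R) `|`
  X 0%N @^-1` [set x | ~ naturals R (1 - x)])).
- exact: measurable_funPTI.
- by apply: measurableU; exact: measurable_funPTI.
- move=> w /= n01; apply/not_andP => -[/natural_complement +] => /[apply].
  tauto.
- by rewrite measureU0//; exact: measurable_funPTI.
Qed.

(** The event S = a, D = b forces N = a + b, and then S = a says that exactly a
    of the first a + b trials succeed: a binomial event independent of N. The
    left-hand side is P(S = a, D = b) by independence. *)
Lemma bernoulli_split_formula p a b :
  0 < p < 1 -> has_bernoulli_law (X 0%N) p ->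
  (P (S @^-1` [set a%:R]) * P (D @^-1` [set b%:R]) =
   P (N @^-1` [set (a + b)%N]) *
     ('C(a + b, a)%:R * p ^+ a * (1 - p) ^+ b)%:E)%E.
Proof.
move=> p01 Xp; have [indX idX] := X_iid.
have mc c := @measurable_set1 R c.
have PX1 i : P (X i @^-1` [set 1]) = p%:E.
  by rewrite -(has_bernoulli_law_eq1 p01 Xp); exact: idX.
have m01 : measurable ([set 0; 1] : set R) by exact: measurableU.
pose E := \bigcap_i (X i @^-1` [set 0; 1]).
(* The event E that all summands are 0 or 1 has probability one; on it S is a
   number of successes. *)
have E1 : P.-negligible (~` E).
  rewrite setC_bigcap; apply: negligible_bigcup => i; rewrite preimage_setC.
  apply/negligibleP; first by apply: measurable_funPTI; exact: measurableC.
  rewrite -(has_bernoulli_law_neq01 p01 Xp); apply: idX; exact: measurableC.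
have SE w n : E w -> \sum_(i < n) X i w = (successes [set 1] X n w)%:R.
  move=> Ew; rewrite /successes natr_sum; apply: eq_bigr => i _.
  have [->|->] := Ew i I.
    by rewrite memNset// => /eqP; rewrite eq_sym oner_eq0.
  by rewrite mem_set.
rewrite -S_indep; [|exact: sigma_rv_preimage|exact: sigma_rv_preimage].
have sigK := @sigma_seq_successes _ _ _ _ _ P X [set 1] (mc 1) (a + b) a.
have := binomial_successes (mc 1) (a + b) a indX PX1; rewrite addKn => <-.
rewrite -X_indep_N//; last exact: sigma_rv_nat.
apply: (eq_measure_on_full _ _ E1).
- apply: measurableI; first exact: measurable_random_sum.
  exact: measurable_sub_random_sum.
- apply: measurableI; first exact: measurable_funPTI.
  exact: sigma_seq_measurable sigK.
apply/seteqP; split=> w [[]] /=; rewrite /random_sum => Sa Db Ew;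
  rewrite !SE// in Sa Db *.
  move/eqP: Sa; rewrite eqr_nat => /eqP Sa; rewrite Sa in Db.
  have Nab : N w = (a + b)%N.
    by apply/eqP; rewrite -(eqr_nat R) natrD -Db subrKC.
  by split=> //; rewrite /= -Nab.
by rewrite Sa Db natrD addrC addKr.
Qed.

(** The factorials and powers in [bernoulli_split_formula] distribute over a
    and b, which leaves n! P(N = n) as a function of a + b alone. *)
Lemma poisson_of_bernoulli p : (P (N @^-1` [set 0%N]) < 1)%E ->
  0 < p < 1 -> has_bernoulli_law (X 0%N) p ->
  exists lambda, 0 < lambda /\ has_poisson_law N lambda.
Proof.
move=> N0 p01 Xp; have /andP[p_gt0 p_lt1] := p01.
have q_gt0 : 0 < 1 - p by rewrite subr_gt0.
have mN n : measurable (N @^-1` [set n]) by exact: measurable_funPTI.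
pose g n := fine (P (N @^-1` [set n])).
have Pg n : P (N @^-1` [set n]) = (g n)%:E by rewrite fineK// fin_num_measure.
pose f a := fine (P (S @^-1` [set a%:R])).
have Pf a : P (S @^-1` [set a%:R]) = (f a)%:E.
  by rewrite fineK// fin_num_measure//; exact: measurable_random_sum.
pose e b := fine (P (D @^-1` [set b%:R])).
have Pe b : P (D @^-1` [set b%:R]) = (e b)%:E.
  by rewrite fineK// fin_num_measure//; exact: measurable_sub_random_sum.
pose h n := g n * n`!%:R.
have fact_neq0 n : n`!%:R != 0 :> R by rewrite pnatr_eq0 -lt0n fact_gt0.
have [] := @split_product_geometric _ h (fun a => f a * a`!%:R / p ^+ a)
    (fun b => e b * b`!%:R / (1 - p) ^+ b).
- move=> a b; have := bernoulli_split_formula a b p01 Xp.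
  rewrite Pf Pe Pg -!EFinM => -[fe].
  have -> : f a * a`!%:R / p ^+ a * (e b * b`!%:R / (1 - p) ^+ b) =
      f a * e b * (a`!%:R * b`!%:R) / (p ^+ a * (1 - p) ^+ b).
    by rewrite invfM; ring.
  have pq : p ^+ a * (1 - p) ^+ b != 0.
    by rewrite mulf_neq0// expf_neq0// gt_eqF.
  apply: (mulIf pq); rewrite divfK// fe /h.
  by rewrite -(@bin_fact (a + b) a) ?leq_addr// addKn !natrM; ring.
- by move=> n; rewrite mulr_ge0// fine_ge0.
- (* Otherwise N would have the law of a point mass at 0. *)
  apply: contrapT => gN0.
  have NE A : distribution P N A = ((g 0%N)%:E * \d_0%N A)%E.
    apply: measure_nat_proportional => -[|n];
      rewrite -[LHS]/(P (N @^-1` [set _])) Pg /= diracE.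
      by rewrite mem_set// mule1.
    rewrite memNset// mule0; congr (_%:E).
    apply: contrapT => /eqP gn; apply: gN0.
    by exists n.+1 => //; rewrite mulf_neq0.
  have := NE setT; rewrite probability_setT diracT mule1 => g1.
  by rewrite Pg -g1 ltxx in N0.
move=> c c_gt0 hc; exists c; split=> //.
have prop A :
    distribution P N A = ((h 0%N * expR c)%:E * poisson_prob c 0%N A)%E.
  apply: (@measure_nat_proportional _ (distribution P N) (poisson_prob c 0%N)).
  move=> n; rewrite -[LHS]/(P (N @^-1` [set n])) Pg /= poisson_prob1// -EFinM.
  congr (_%:E); apply: (mulIf (fact_neq0 n)); rewrite -/(h n) hc expRN.
  have := expR_gt0 c => /gt_eqF/negbT c0.
  by field; rewrite c0 fact_neq0.
(* Both sides have total mass one. *)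
have C1 : h 0%N * expR c = 1.
  have := prop setT; rewrite !probability_setT mule1 => -[].
  by move=> <-.
by move=> A; rewrite prop C1 mul1e.
Qed.

End split_of_random_sum.

Theorem theorem4p1 (R : realType) (d : measure_display) (T : measurableType d)
    (P : probability T R) (N : {RV P >-> nat}) (X : nat -> {RV P >-> R})
    (N_neq0 : (P (N @^-1` [set 0%N]) < 1)%E)
    (X_iid : iid X)
    (X_mean : P.-integrable [set: T] (EFin \o X 0%N))
    (X_indep_N : indep_systems P (sigma_rv N) (sigma_seq X))
    (S_indep : indep_systems P
      (sigma_rv (random_sum N X))
      (sigma_rv (fun w => (N w)%:R - random_sum N X w))) :
  ((exists p : R, 0 < p < 1 /\ has_bernoulli_law (X 0%N) p) ->
     exists lambda : R, 0 < lambda /\ has_poisson_law N lambda) /\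
  ((exists lambda : R, 0 < lambda /\ has_poisson_law N lambda) ->
     (P (X 0%N @^-1` [set 0%R]) < 1)%E ->
     (P (X 0%N @^-1` [set 1%R]) < 1)%E ->
     exists p : R, 0 < p < 1 /\ has_bernoulli_law (X 0%N) p).
Proof.
split=> [[p [p01 Xp]]|[lambda [lambda_gt0 NPoisson]] X0 X1].
  exact: (poisson_of_bernoulli X_iid X_indep_N S_indep N_neq0 p01 Xp).
have Npos n : P (N @^-1` [set n]) != 0%E.
  rewrite -[P _]/(distribution P N [set n]) NPoisson poisson_prob1//.
  rewrite eqe gt_eqF//.
  by rewrite mulr_gt0 ?expR_gt0// divr_gt0 ?exprn_gt0// ltr0n fact_gt0.
apply: two_valued_bernoulli_law => //.
exact: (one_summand_two_valued X_indep_N S_indep).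
Qed.
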